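(* Let $B=(V,E)$ be a (two-sided) generalized Bratteli diagram of bounded size with corresponding sequence $(t_n,L_n)_{n\in\mathbb N_0}$, equipped with the left-to-right ordering $\omega$. Suppose $L_n=2$ for all $n\in\mathbb N$, and that there exists $N\in\mathbb N_0$ such that $$t_{N+k}=\sum_{i=N}^{N+k-1}t_i\qquad\text{for all }k\in\mathbb N .$$ Then there exists a continuous Vershik map $X_B\to X_B$ corresponding to $\omega$.
   Context: $\mathbb N=\{1,2,\dots\}$, $\mathbb N_0=\mathbb N\cup\{0\}$. A generalized Bratteli diagram is a graded graph $B=(V,E)$ with $V=\bigsqcup_{i\ge0}V_i$, $E=\bigsqcup_{i\ge0}E_i$, where every level $V_i$ is countably infinite, $E_i$ is a countable set of edges from $V_i$ to $V_{i+1}$ with source and range maps $s,r$ satisfying $s(E_i)=V_i$, $r(E_i)=V_{i+1}$, and $|r^{-1}(v)|<\infty$ for every $v\in V\setminus V_0$. The path space $X_B$ is the set of infinite paths $x=(x_i)_{i\ge0}$, $x_i\in E_i$, $r(x_i)=s(x_{i+1})$, with the topology generated by the cylinder sets $[\overline e]=\{x: x_0=e_0,\dots,x_n=e_n\}$. For $w\in V_n$, $v\in V_m$, $n<m$, $E(w,v)$ is the set of finite paths from $w$ to $v$. Bounded size: every level $V_n$ is identified with $\mathbb Z$, and there are pairs of natural numbers $(t_n,L_n)_{n\in\mathbb N_0}$ such that for all $n\in\mathbb N_0$ and $v\in V_{n+1}$: $s(r^{-1}(v))\subset\{v-t_n,\dots,v+t_n\}$ and $|r^{-1}(v)|=\sum_{w\in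 V_n}|E(w,v)|\le L_n$. Convention: for each $n$, $t_n$ and $L_n$ are chosen minimal possible, and $E(v-t_n,v)$ and $E(v+t_n,v)$ are nonempty for all $n\in\mathbb N_0$ and all $v\in V_{n+1}$. Order: an ordered diagram carries a linear order on each finite set $r^{-1}(v)$, $v\in V\setminus V_0$. The order is left-to-right if for $e,f\in r^{-1}(v)$, $s(e)<s(f)$ implies $e<f$. A (finite or infinite) path is maximal (minimal) if each of its edges $e_i$ is maximal (minimal) in $r^{-1}(r(e_i))$; $X_{max}$, $X_{min}$ are the sets of infinite maximal, minimal paths. The map $\varphi_B:X_B\setminus X_{max}\to X_B\setminus X_{min}$ sends $x=(x_0,x_1,\dots)$ to $(g_0,\dots,g_{m-1},g_m,x_{m+1},\dots)$, where $m$ is the least index with $x_m$ not maximal, $g_m$ is the successor of $x_m$ in $r^{-1}(r(x_m))$ and $(g_0,\dots,g_{m-1})$ is the minimal path from $V_0$ to $s(g_m)$. A Vershik map is any extension of this map to a Borel bijection $X_B\to X_B$. *)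

(* Defs.v *)
From HB Require Import structures.
From mathcomp Require Import all_boot all_order all_algebra.
From mathcomp Require Import all_classical topology measurable_structure.

Set Implicit Arguments.
Unset Strict Implicit.
Unset Printing Implicit Defensive.

Import Order.TTheory GRing.Theory Num.Theory.

Local Open Scope classical_set_scope.

Record bratteli := Bratteli {
  vertex : nat -> countType;
  edge : nat -> countType;
  src : forall n, edge n -> vertex n;
  rng : forall n, edge n -> vertex n.+1;
  vertex_infinite : forall n, infinite_set [set: vertex n];
  src_surj : forall n (w : vertex n), exists e : edge n, src e = w;
  rng_surj : forall n (v : vertex n.+1), exists e : edge n, rng e = v;
  rng_fiber_finite : forall n (v : vertex n.+1),
    finite_set [set e : edge n | rng e = v] }.

Arguments src {b n} e.
Arguments rng {b n} e.

Record path_space (B : bratteli) := Path {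
  path_edge :> forall n, edge B n;
  path_edgeP : forall n, rng (path_edge n) = src (path_edge n.+1) }.

(* Since every vertex is the source of an edge, every finite path extends to
   an infinite one; hence the cylinder sets of finite paths are exactly the
   sets [cylinder x n], whose defining finite path is (x 0, ..., x n). *)
Definition cylinder (B : bratteli) (x : path_space B) (n : nat) :
    set (path_space B) :=
  [set y | forall i, (i <= n)%N -> y i = x i].

HB.instance Definition _ (B : bratteli) := gen_eqMixin (path_space B).
HB.instance Definition _ (B : bratteli) := gen_choiceMixin (path_space B).
HB.instance Definition _ (B : bratteli) :=
  isSubBaseTopological.Build (path_space B)
    [set C : set (path_space B) | exists x n, C = cylinder x n] id.

(* Only the restriction of [edge_le] to each fiber of [rng] is meaningful. *)
Record edge_order (B : bratteli) := EdgeOrder {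
  edge_le : forall n, rel (edge B n);
  edge_le_refl : forall n (e : edge B n), edge_le e e;
  edge_le_anti : forall n (e f : edge B n), rng e = rng f ->
    edge_le e f -> edge_le f e -> e = f;
  edge_le_trans : forall n (e f g : edge B n),
    rng e = rng f -> rng f = rng g ->
    edge_le e f -> edge_le f g -> edge_le e g;
  edge_le_total : forall n (e f : edge B n), rng e = rng f ->
    edge_le e f || edge_le f e }.

Section Vershik.
Variables (B : bratteli) (o : edge_order B).

Definition edge_lt n (e f : edge B n) : bool := (e != f) && edge_le o e f.

Definition max_edge n (e : edge B n) : Prop :=
  forall f : edge B n, rng f = rng e -> edge_le o f e.

Definition min_edge n (e : edge B n) : Prop :=
  forall f : edge B n, rng f = rng e -> edge_le o e f.

Definition succ_edge n (e g : edge B n) : Prop :=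
  [/\ rng g = rng e, edge_lt e g &
      forall f : edge B n, rng f = rng e -> edge_lt e f -> edge_le o g f].

Definition max_path (x : path_space B) : Prop := forall n, max_edge (x n).

(* The graph of the map phi_B: [y] is determined by [x], because a minimal
   finite path is determined by its final vertex. *)
Definition vershik_graph (x y : path_space B) : Prop :=
  exists m, [/\ ~ max_edge (x m),
    forall i, (i < m)%N -> max_edge (x i),
    succ_edge (x m) (y m),
    forall i, (i < m)%N -> min_edge (y i) &
    forall i, (m < i)%N -> y i = x i].

Definition borel_map (f : path_space B -> path_space B) : Prop :=
  forall A, <<s open >> A -> <<s open >> (f @^-1` A).

Definition vershik_map (f : path_space B -> path_space B) : Prop :=
  [/\ bijective f, borel_map f & forall x, ~ max_path x -> vershik_graph x (f x)].

End Vershik.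

Section BoundedSize.
Variables (B : bratteli) (lab : forall n, vertex B n -> int).
Arguments lab {n} _.
Local Open Scope ring_scope.

(* The convention here is that the natural numbers t_n, L_n start at 1. *)
Definition level_bounds (n t L : nat) : Prop :=
  [/\ (0 < t)%N, (0 < L)%N,
    forall e : edge B n, lab (rng e) - t%:Z <= lab (src e) <= lab (rng e) + t%:Z
    & forall v : vertex B n.+1,
      ([set e : edge B n | rng e = v] #<= `I_L)%card].

Definition bounded_size (t L : nat -> nat) : Prop :=
  (forall n, bijective (@lab n)) /\
  forall n, [/\ level_bounds n (t n) (L n),
    forall t' L', level_bounds n t' L' -> (t n <= t')%N /\ (L n <= L')%N,
    forall v : vertex B n.+1,
      exists e : edge B n, rng e = v /\ lab (src e) = lab v - (t n)%:Z
    & forall v : vertex B n.+1,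
      exists e : edge B n, rng e = v /\ lab (src e) = lab v + (t n)%:Z].

Definition left_to_right (o : edge_order B) : Prop :=
  forall n (e f : edge B n), rng e = rng f ->
    lab (src e) < lab (src f) -> edge_lt o e f.

End BoundedSize.

(* Main.v *)
Require Import Defs.
From mathcomp Require Import all_boot all_order all_algebra.
From mathcomp Require Import all_classical topology.
From mathcomp Require Import measurable_structure finmap zify.

(** Write [S_n] for the sum of [t_i] over [i < n].  In the left-to-right order
    the maximal edge into [v] starts at [v + t_n] and the minimal one at
    [v - t_n].  Hence a maximal path is determined by its starting vertex [w]
    and passes through [w - S_n] at level [n]; symmetrically, a minimal path
    from [w] passes through [w + S_n].  Both exist for every [w], so the
    infinite maximal paths, and likewise the minimal ones, are indexed by the
    integers, and extending the Vershik map to a bijection amounts to pairing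
    the two families.

    Continuity decides the pairing.  Let [x] be a nonmaximal path that agrees
    for a long time with the maximal path from [w], and let [m > 0] be the
    first level where [x] is not maximal.  A fiber at a positive level has
    just two edges, so [x_m] is the minimal edge from [w - S_m] to
    [w - S_m + t_m], and its successor is the maximal edge there, with source
    [w - S_m + 2 t_m].  The minimal path that reaches this source starts at
    [w - 2 S_m + 2 t_m].  The hypothesis on [t] says exactly that
    [S_m - t_m = S_N] for all [m > N], so this start is [w - 2 S_N], whatever
    [m] is ([vershik_graph_near_max]).  Sending the maximal path from [w] to
    the minimal path from [w - 2 S_N] is therefore continuous at maximal paths
    and is a bijection between the two families.  At the other paths the
    Vershik map only modifies a prefix of locally constant length
    ([vershik_graph_local]).

    Bijectivity comes from a duality: reversing all the orders exchanges
    maximal and minimal, successor and predecessor, and turns the extended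
    Vershik relation into its converse ([vershik_ext_rev]).  So it is enough
    to show that this relation is total and functional; the same two facts for
    the reversed order provide the inverse map. *)

Set Implicit Arguments.
Unset Strict Implicit.
Unset Printing Implicit Defensive.

Import Order.TTheory GRing.Theory Num.Theory.

Local Open Scope classical_set_scope.

(** * Extremal edges in a fiber *)

Definition rev_order (B : bratteli) (o : edge_order B) : edge_order B.
Proof.
refine (@EdgeOrder B (fun n e f => edge_le o f e) _ _ _ _).
- by move=> n e; exact: edge_le_refl.
- by move=> n e f ref ef fe; exact: (edge_le_anti ref fe ef).
- move=> n e f g ref rfg fe gf.
  by apply: (edge_le_trans _ _ gf fe); [rewrite rfg | rewrite ref].
- by move=> n e f ref; exact: (edge_le_total o (esym ref)).
Defined.

Lemma edge_lt_neg (B : bratteli) (o : edge_order B) n (e f : edge B n) :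
  rng e = rng f -> ~ edge_lt o e f -> edge_le o f e.
Proof.
move=> ref; rewrite /edge_lt; case: eqVneq => [->|_] /=.
  by move=> _; exact: edge_le_refl.
by move=> nef; case/orP: (edge_le_total o ref).
Qed.

Lemma edge_lt_asym (B : bratteli) (o : edge_order B) n (e f : edge B n) :
  rng e = rng f -> edge_lt o e f -> edge_le o f e -> False.
Proof.
move=> ref /andP[/eqP nef lef] lfe; exact/nef/(edge_le_anti ref lef lfe).
Qed.

(** Stated for any nonempty part of a fiber, so that it yields both the minimal
    edge of the fiber and, among the larger edges, the successor of an edge. *)
Lemma fiber_least (B : bratteli) (o : edge_order B) n (v : vertex B n.+1)
    (A : set (edge B n)) :
  A `<=` [set e | rng e = v] -> A !=set0 ->
  exists e, A e /\ forall f, A f -> edge_le o e f.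
Proof.
move=> Av A0; have /finite_seqP[s As] := sub_finite_set Av (rng_fiber_finite v).
have : forall r : seq (edge B n), {subset r <= [pred e | `[<A e>]]} ->
    r = [::] \/ exists e, A e /\ forall f, f \in r -> edge_le o e f.
  elim=> [|e r IH] sub; [by left | right].
  have Ae : A e by apply/asboolP/sub; rewrite inE eqxx.
  case: IH => [f fr||[f [Af fmin]]]; first by apply: sub; rewrite inE fr orbT.
    move=> ->; exists e; split=> // f.
    by rewrite inE => /eqP ->; exact: edge_le_refl.
  have [ref] : rng e = rng f by rewrite (Av _ Ae) (Av _ Af).
  case/orP: (edge_le_total o ref) => [ef|fe].
    exists e; split=> // g; rewrite inE => /orP[/eqP ->|gr].
      exact: edge_le_refl.
    have gA : A g by apply/asboolP/sub; rewrite inE gr orbT.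
    apply: (edge_le_trans _ _ ef (fmin _ gr)) => //.
    by rewrite (Av _ Af) (Av _ gA).
  by exists f; split=> // g; rewrite inE => /orP[/eqP ->|] //; exact: fmin.
move=> /(_ s) [e|s0|[e [Ae emin]]].
- by move=> es; apply/asboolP; rewrite As.
- by case: A0 => e; rewrite As s0.
- by exists e; split=> // f; rewrite {1}As; exact: emin.
Qed.

Lemma min_edge_exists (B : bratteli) (o : edge_order B) n (v : vertex B n.+1) :
  exists e : edge B n, rng e = v /\ min_edge o e.
Proof.
have [e [ev emin]] : exists e : edge B n, rng e = v /\
    forall f, rng f = v -> edge_le o e f.
  by apply: (@fiber_least B o n v) => //; exact: rng_surj.
by exists e; split=> // f; rewrite ev => /emin.
Qed.

Lemma min_edge_unique (B : bratteli) (o : edge_order B) n (e f : edge B n) :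
  min_edge o e -> min_edge o f -> rng e = rng f -> e = f.
Proof.
move=> emin fmin ref; apply: (edge_le_anti ref); first exact/emin/esym.
exact: fmin.
Qed.

Lemma succ_edge_exists (B : bratteli) (o : edge_order B) n (e : edge B n) :
  ~ max_edge o e -> exists g, succ_edge o e g.
Proof.
move=> nmax.
have [h [rh nhe]] : exists h : edge B n, rng h = rng e /\ ~ edge_le o h e.
  apply: contrapT => no; apply: nmax => f rf.
  by apply: contrapT => nle; apply: no; exists f.
have [g [[rg lt_eg] gmin]] : exists g : edge B n,
    (rng g = rng e /\ edge_lt o e g) /\
    forall f, rng f = rng e /\ edge_lt o e f -> edge_le o g f.
  apply: (@fiber_least B o n (rng e)) => [f []//|].
  exists h; split=> //; apply: contrapT => /edge_lt_neg => nlt.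
  exact/nhe/nlt/esym.
by exists g; split=> // f rf lf; exact: gmin.
Qed.

Lemma succ_edge_unique (B : bratteli) (o : edge_order B) n (e g h : edge B n) :
  succ_edge o e g -> succ_edge o e h -> g = h.
Proof.
move=> [rg lg ming] [rh lh minh]; apply: (@edge_le_anti B o).
- by rewrite rg rh.
- exact: ming.
- exact: minh.
Qed.

(** By totality, an edge below the successor [g] of [e] is at most [e]. *)
Lemma succ_edge_rev (B : bratteli) (o : edge_order B) n (e g : edge B n) :
  succ_edge o e g -> succ_edge (rev_order o) g e.
Proof.
move=> [rg lg ming]; split=> //.
  by move: lg; rewrite /edge_lt eq_sym.
move=> f rf fg /=; apply: edge_lt_neg => [|ef]; first by rewrite rf rg.
apply: (@edge_lt_asym B o n f g) => //.
  by move: fg; rewrite /edge_lt eq_sym.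
by apply: ming => //; rewrite rf.
Qed.

(** * The Vershik map off the maximal paths *)

Definition min_path (B : bratteli) (o : edge_order B) (x : path_space B) :=
  forall n, min_edge o (x n).

Lemma path_ext (B : bratteli) (x y : path_space B) :
  (forall n, x n = y n) -> x = y.
Proof.
case: x y => [x hx] [y hy] /= xy.
have {}xy : x = y by exact: functional_extensionality_dep.
by case: y / xy hy => hy; rewrite (Prop_irrelevance hx hy).
Qed.

(** Minimal edges are chosen backwards from level [m].  The family [z] is only
    constrained from level [m] on, so that the induction may overwrite one
    entry at a time and repair compatibility at the junction. *)
Lemma min_prefix_exists (B : bratteli) (o : edge_order B) m
    (z : forall i, edge B i) :
  (forall i, (m <= i)%N -> rng (z i) = src (z i.+1)) ->
  exists y : path_space B, (forall i, (m <= i)%N -> y i = z i) /\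
    (forall i, (i < m)%N -> min_edge o (y i)).
Proof.
elim: m z => [|m IH] z zP.
  by exists (@Path B z (fun i => zP i isT)).
have [e [re emin]] := min_edge_exists o (src (z m.+1)).
have ze i : (m < i)%N -> dfwith z m e i = z i.
  by move=> mi; rewrite dfwithout// neq_ltn mi.
have [i|y [yz ymin]] := IH (dfwith z m e).
  rewrite leq_eqVlt => /predU1P[<-|mi]; first by rewrite dfwithin ze.
  by rewrite !ze//; [exact: zP | exact: leqW].
exists y; split=> i; first by move=> mi; rewrite yz ?ze// ltnW.
rewrite ltnS leq_eqVlt => /predU1P[->|]; last exact: ymin.
by rewrite yz// dfwithin.
Qed.

Lemma min_prefix_end_eq (B : bratteli) (o : edge_order B) m
    (x y : path_space B) :
  (forall i, (i < m)%N -> min_edge o (x i)) ->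
  (forall i, (i < m)%N -> min_edge o (y i)) ->
  src (x m) = src (y m) ->
  forall i, (i < m)%N -> x i = y i.
Proof.
elim: m => // m IH xmin ymin xy.
have xym : x m = y m.
  apply: (@min_edge_unique B o); [exact: xmin | exact: ymin |].
  by rewrite !path_edgeP.
move=> i; rewrite ltnS leq_eqVlt => /predU1P[->//|].
apply: IH => [j jm|j jm|]; [exact/xmin/leqW | exact/ymin/leqW |].
by rewrite xym.
Qed.

Lemma vershik_graph_total (B : bratteli) (o : edge_order B)
    (x : path_space B) :
  ~ max_path o x -> exists y, vershik_graph o x y.
Proof.
move=> nmax.
have ex : exists m, `[<~ max_edge o (x m)>].
  apply: contrapT => no; apply: nmax => n; apply: contrapT => nx.
  by apply: no; exists n; apply/asboolP.
case: (ex_minnP ex) => m /asboolP xm mleast.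
have [g sg] := succ_edge_exists xm; have [rg _ _] := sg.
have xe i : (m < i)%N -> dfwith x m g i = x i.
  by move=> mi; rewrite dfwithout// neq_ltn mi.
have [i|y [yz ymin]] := @min_prefix_exists B o m (dfwith x m g).
  rewrite leq_eqVlt => /predU1P[<-|mi].
    by rewrite dfwithin xe// rg path_edgeP.
  by rewrite !xe//; [exact: path_edgeP | exact: leqW].
exists y, m; split=> //.
- move=> i im; apply: contrapT => ni.
  by have := mleast i (asboolT ni); rewrite leqNgt im.
- by rewrite yz// dfwithin.
- by move=> i mi; rewrite yz ?xe// ltnW.
Qed.

(** The first nonmaximal level is already visible on the prefix up to [m], and
    below it the image is the unique minimal prefix reaching a given vertex.
    The same statement serves for continuity at [x] and, with [x' = x], for
    functionality of the relation. *)
Lemma vershik_graph_local (B : bratteli) (o : edge_order B)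
    (x y : path_space B) :
  vershik_graph o x y ->
  exists m, ~ max_edge o (x m) /\
    forall k x' y', (m <= k)%N -> cylinder x k x' -> vershik_graph o x' y' ->
    cylinder y k y'.
Proof.
move=> [m [xm xmax xy ymin yx]]; exists m; split=> // k x' y' mk xx'.
move=> [m' [xm' xmax' xy' ymin' yx']].
have mm' : m' = m.
  case: (ltngtP m' m) => // [m'm|mm'].
    case: xm'; rewrite xx'; last exact: leq_trans (ltnW m'm) mk.
    exact: xmax.
  by case: xm; rewrite -xx'//; exact: xmax'.
rewrite {m'}mm' in xm' xmax' xy' ymin' yx'.
have yy'm : y' m = y m.
  by apply: (succ_edge_unique (o := o) (e := x m)); rewrite // -xx'.
move=> i ik; case: (ltngtP i m) => [im|mi|->//].
  by apply: (min_prefix_end_eq ymin' ymin) => //; rewrite yy'm.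
by rewrite yx' // yx // xx'.
Qed.

(** The converse needs no separate proof, because [rev_order] is involutive up
    to conversion of the relations [edge_le]. *)
Lemma vershik_graph_rev (B : bratteli) (o : edge_order B)
    (x y : path_space B) :
  vershik_graph o x y -> vershik_graph (rev_order o) y x.
Proof.
move=> [m [xm xmax xy ymin yx]]; exists m; split=> //.
- move=> ymax; have [rg lt_xy _] := xy.
  by apply: (edge_lt_asym (esym rg) lt_xy); exact: (ymax (x m) (esym rg)).
- exact: succ_edge_rev.
- by move=> i mi; rewrite yx.
Qed.

(** * Minimal paths in a labelled diagram *)

(** Stated for an arbitrary displacement [s] so that, applied to the reversed
    order and to [- s], it also describes the maximal edges. *)
Definition min_step (B : bratteli) (o : edge_order B)
    (lab : forall n, vertex B n -> int) (s : nat -> int) : Prop :=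
  forall n (e : edge B n), min_edge o e ->
    lab n.+1 (rng e) = (lab n (src e) + s n)%R.

Lemma min_prefix_label (B : bratteli) (o : edge_order B)
    (lab : forall n, vertex B n -> int) (s : nat -> int) m
    (x : path_space B) :
  min_step o lab s -> (forall i, (i < m)%N -> min_edge o (x i)) ->
  lab m (src (x m)) = (lab 0 (src (x 0)) + \sum_(0 <= i < m) s i)%R.
Proof.
move=> os; elim: m => [|m IH] xmin; first by rewrite big_geq// addr0.
rewrite big_nat_recr//= addrA -IH => [|i im]; last exact/xmin/leqW.
by rewrite -path_edgeP os//; exact: xmin.
Qed.

Lemma min_prefix_start_eq (B : bratteli) (o : edge_order B)
    (lab : forall n, vertex B n -> int) (s : nat -> int) m
    (x y : path_space B) :
  (forall n, injective (@lab n)) -> min_step o lab s ->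
  (forall i, (i < m)%N -> min_edge o (x i)) ->
  (forall i, (i < m)%N -> min_edge o (y i)) ->
  lab 0 (src (x 0)) = lab 0 (src (y 0)) ->
  forall i, (i < m)%N -> x i = y i.
Proof.
move=> labI os xmin ymin xy; apply: (min_prefix_end_eq xmin ymin).
apply: labI.
by rewrite (min_prefix_label os xmin) (min_prefix_label os ymin) xy.
Qed.

(** The path goes through the vertices labelled by [a] plus the partial sums of
    [s]: the minimal edge into each of these vertices comes from the
    previous one. *)
Lemma min_path_exists (B : bratteli) (o : edge_order B)
    (lab : forall n, vertex B n -> int) (s : nat -> int) (a : int) :
  (forall n, bijective (@lab n)) -> min_step o lab s ->
  exists y : path_space B, min_path o y /\ lab 0 (src (y 0)) = a.
Proof.
move=> labB os.
have ex n : exists e : edge B n, min_edge o e /\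
    lab n (src e) = (a + \sum_(0 <= i < n) s i)%R.
  have [u _ uK] := labB n.+1.
  have [e [re emin]] :=
    min_edge_exists o (u (a + \sum_(0 <= i < n.+1) s i)%R).
  exists e; split=> //; apply: (addIr (s n)).
  by rewrite -os// re uK big_nat_recr//= addrA.
pose e n := proj1_sig (cid (ex n)).
have eP n : min_edge o (e n) /\ lab n (src (e n)) =
    (a + \sum_(0 <= i < n) s i)%R := proj2_sig (cid (ex n)).
have ePath n : rng (e n) = src (e n.+1).
  apply: (bij_inj (labB n.+1)); rewrite os; last exact: (eP n).1.
  by rewrite (eP n).2 (eP n.+1).2 big_nat_recr//= addrA.
exists (Path ePath); split=> [n|]; first exact: (eP n).1.
by rewrite /= (eP 0).2 big_geq// addr0.
Qed.

(** * Extending the Vershik map by a translation of the maximal paths *)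

(** The displacement [d] between the starting labels is kept arbitrary here:
    only continuity forces its value. *)
Definition vershik_ext (B : bratteli) (o : edge_order B)
    (lab : forall n, vertex B n -> int) (d : int) (x y : path_space B) : Prop :=
  [/\ max_path o x, min_path o y &
      lab 0 (src (y 0)) = (lab 0 (src (x 0)) + d)%R] \/ vershik_graph o x y.

Lemma vershik_ext_rev (B : bratteli) (o : edge_order B)
    (lab : forall n, vertex B n -> int) (d : int) (x y : path_space B) :
  vershik_ext o lab d x y <-> vershik_ext (rev_order o) lab (- d)%R y x.
Proof.
split=> [[[xmax ymin yx]|/vershik_graph_rev]|]; [|by right|].
  by left; split=> //; rewrite yx addrK.
case=> [[xmax ymin yx]|/vershik_graph_rev]; last by right.
by left; split=> //; rewrite yx addrNK.
Qed.

Lemma vershik_ext_total (B : bratteli) (o : edge_order B)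
    (lab : forall n, vertex B n -> int) (s : nat -> int) (d : int)
    (x : path_space B) :
  (forall n, bijective (@lab n)) -> min_step o lab s ->
  exists y, vershik_ext o lab d x y.
Proof.
move=> labB os; case: (pselect (max_path o x)) => [xmax|].
  have [y [ymin ylab]] := min_path_exists (lab 0 (src (x 0)) + d)%R labB os.
  by exists y; left.
by move=> /vershik_graph_total[y xy]; exists y; right.
Qed.

Lemma vershik_graph_not_max (B : bratteli) (o : edge_order B)
    (x y : path_space B) :
  vershik_graph o x y -> ~ max_path o x.
Proof. by move=> [m [xm _ _ _ _]] xmax; exact/xm/xmax. Qed.

Lemma vershik_ext_functional (B : bratteli) (o : edge_order B)
    (lab : forall n, vertex B n -> int) (s : nat -> int) (d : int)
    (x y y' : path_space B) :
  (forall n, injective (@lab n)) -> min_step o lab s ->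
  vershik_ext o lab d x y -> vershik_ext o lab d x y' -> y = y'.
Proof.
move=> labI os [[xmax ymin yx]|xy] [[xmax' ymin' yx']|xy'].
- apply: path_ext => n.
  apply: (@min_prefix_start_eq B o lab s n.+1) => //.
  by rewrite yx yx'.
- by have := vershik_graph_not_max xy'.
- by have := vershik_graph_not_max xy.
- apply: path_ext => n; have [m [_ loc]] := vershik_graph_local xy.
  by apply/esym/(loc (maxn m n) x y'); rewrite ?leq_maxl ?leq_maxr.
Qed.

(** * Topology of the path space *)

Lemma cylinder_open (B : bratteli) (x : path_space B) n : open (cylinder x n).
Proof.
exists [set cylinder x n]; last by rewrite bigcup_set1.
move=> _ ->; exists [fset cylinder x n]%fset.
  by move=> C; rewrite inE => /eqP ->; apply/mem_set; exists x, n.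
by rewrite set_fset1 bigcap_set1.
Qed.

(** Cylinders around a point form a neighborhood base, although they are only
    given as a subbase: two cylinders through [x] are nested. *)
Lemma open_cylinder (B : bratteli) (A : set (path_space B))
    (x : path_space B) :
  open A -> A x -> exists n, cylinder x n `<=` A.
Proof.
case=> D Dfin <- [C DC Cx].
suff [n nC] : exists n, cylinder x n `<=` C.
  by exists n => y /nC Cy; exists C.
have [F Fcyl CE] := Dfin _ DC.
have bound (C' : set (path_space B)) : C' \in F ->
    exists n, cylinder x n `<=` C'.
  move=> C'F; have : C' x by rewrite -CE in Cx; exact: Cx.
  have /set_mem[z [n ->]] := Fcyl _ C'F.
  by move=> zx; exists n => y xy i ni; rewrite xy// zx.
have [n nP] : exists n, forall C', C' \in enum_fset F -> cylinder x n `<=` C'.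
  have : {subset (enum_fset F) <= F} by [].
  elim: (enum_fset F) => [|C' r IH] sub.
    by exists 0 => C'; rewrite in_nil.
  have [j jP] : exists n, cylinder x n `<=` C'.
    by apply: bound; apply: sub; rewrite inE eqxx.
  have [C'' C''r|k kP] := IH; first by apply: sub; rewrite inE C''r orbT.
  exists (maxn j k) => C''; rewrite inE => /predU1P[->|C''r] y xy.
    by apply: jP => i ij; apply: xy; rewrite leq_max ij.
  by apply: (kP _ C''r) => i ik; apply: xy; rewrite leq_max ik orbT.
by exists n => y xy; rewrite -CE => C' C'F; exact: nP xy.
Qed.

Lemma cylinder_continuous (B : bratteli) (f : path_space B -> path_space B) :
  (forall x n, exists k, forall x', cylinder x k x' ->
    cylinder (f x) n (f x')) -> continuous f.
Proof.
move=> loc x A; rewrite !nbhsE => -[U [Uo Ux] UA].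
have [n nU] := open_cylinder Uo Ux; have [k kn] := loc x n.
exists (cylinder x k); first by split; [exact: cylinder_open | move=> i].
by move=> x' /kn/nU/UA.
Qed.

Lemma continuous_borel (B : bratteli) (f : path_space B -> path_space B) :
  continuous f -> borel_map f.
Proof.
move=> fc; apply: smallest_sub => [|A Ao].
  have := sigma_algebra_image f
    (smallest_sigma_algebra setT (@open (path_space B))).
  by rewrite /image_set_system; under eq_set do rewrite setTI.
by apply: sub_sigma_algebra; move/continuousP: fc; exact.
Qed.

(** * Diagrams of bounded size *)

(** An edge with the smallest possible source is strictly below all the edges
    of its fiber with another source, so the minimal edge has that source. *)
Lemma min_edge_leftmost (B : bratteli) (o : edge_order B)
    (lab : forall n, vertex B n -> int) n (t : int) :
  left_to_right lab o ->
  (forall e : edge B n, (lab n.+1 (rng e) - t <= lab n (src e))%R) ->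
  (forall v : vertex B n.+1, exists e : edge B n,
    rng e = v /\ lab n (src e) = (lab n.+1 v - t)%R) ->
  forall e : edge B n, min_edge o e ->
    lab n.+1 (rng e) = (lab n (src e) + t)%R.
Proof.
move=> ho lb ex e emin; have [f [rf fsrc]] := ex (rng e).
apply: contrapT => ne.
have lt_fe : edge_lt o f e by apply: ho => //; have := lb e; lia.
by apply: (edge_lt_asym rf lt_fe); exact: emin.
Qed.

Lemma left_to_right_rev (B : bratteli) (o : edge_order B)
    (lab : forall n, vertex B n -> int) :
  left_to_right lab o ->
  left_to_right (fun n v => (- lab n v)%R) (rev_order o).
Proof.
move=> ho n e f ref lt_ef; have : edge_lt o f e.
  by apply: ho => //; move: lt_ef; lia.
by rewrite /edge_lt eq_sym.
Qed.

Lemma bounded_size_min_step (B : bratteli) (o : edge_order B)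
    (lab : forall n, vertex B n -> int) (t L : nat -> nat) :
  bounded_size lab t L -> left_to_right lab o ->
  min_step o lab (fun n => (t n)%:Z%R).
Proof.
move=> [_ hB] ho n e emin; have [[_ _ bd _] _ exl _] := hB n.
by apply: (min_edge_leftmost ho _ exl) => // f; have := bd f; lia.
Qed.

(** Negating the labels makes the reversed order left-to-right. *)
Lemma bounded_size_max_step (B : bratteli) (o : edge_order B)
    (lab : forall n, vertex B n -> int) (t L : nat -> nat) :
  bounded_size lab t L -> left_to_right lab o ->
  min_step (rev_order o) lab (fun n => (- (t n)%:Z)%R).
Proof.
move=> [_ hB] ho n e emin; have [[_ _ bd _] _ _ exr] := hB n.
have ex v : exists f : edge B n,
    rng f = v /\ (- lab n (src f) = - lab n.+1 v - (t n)%:Z)%R.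
  by have [f [rf fsrc]] := exr v; exists f; split=> //; lia.
have lb (f : edge B n) :
    (- lab n.+1 (rng f) - (t n)%:Z <= - lab n (src f))%R.
  by have := bd f; lia.
have := min_edge_leftmost (left_to_right_rev ho) lb ex emin; lia.
Qed.

Lemma card_le2_eq (T : Type) (A : set T) (a b c : T) :
  (A #<= `I_2)%card -> A a -> A b -> A c -> a <> b -> c = a \/ c = b.
Proof.
case/pcard_leP => f Aa Ab Ac ab.
have f2 x : A x -> (f x < 2)%N by move=> Ax; exact: (@funS _ _ A `I_2 f x Ax).
have fI x y : A x -> A y -> f x = f y -> x = y.
  by move=> Ax Ay; apply: inj; exact: mem_set.
have := f2 _ Aa; have := f2 _ Ab; have := f2 _ Ac => fc fb fa.
have fab : f a <> f b by move/(fI _ _ Aa Ab).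
have [/(fI _ _ Ac Aa)|/(fI _ _ Ac Ab)] : f c = f a \/ f c = f b by lia.
  by left.
by right.
Qed.

Lemma succ_edge_two (B : bratteli) (o : edge_order B) n (e g : edge B n) :
  ([set f : edge B n | rng f = rng e] #<= `I_2)%card -> succ_edge o e g ->
  min_edge o e /\ max_edge o g.
Proof.
move=> two [rg /andP[/eqP neg leg] _].
have fib f : rng f = rng e -> f = e \/ f = g.
  by move=> rf; exact: (card_le2_eq two).
split=> f; rewrite ?rg => /fib[] -> //; exact: edge_le_refl.
Qed.

(** The computation that singles out the displacement [- 2 S_N]: the first
    nonmaximal level [m] of [x] satisfies [m > k >= N], and its contribution
    cancels because [t m] is the sum of the [t i] for [N <= i < m]. *)
Lemma vershik_graph_near_max (B : bratteli) (o : edge_order B)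
    (lab : forall n, vertex B n -> int) (t L : nat -> nat) (N k : nat)
    (x y : path_space B) :
  bounded_size lab t L -> left_to_right lab o ->
  (forall n, (0 < n)%N -> L n = 2) ->
  (forall k, (0 < k)%N -> t (N + k)%N = (\sum_(N <= i < N + k) t i)%N) ->
  (N <= k)%N -> (forall i, (i <= k)%N -> max_edge o (x i)) ->
  vershik_graph o x y ->
  (forall i, (i <= k)%N -> min_edge o (y i)) /\
  lab 0 (src (y 0)) =
    (lab 0 (src (x 0)) - (\sum_(0 <= i < N) (t i)%:Z) *+ 2)%R.
Proof.
move=> hB ho hL ht Nk xk [m [xm xmax xy ymin _]].
have km : (k < m)%N by rewrite ltnNge; apply/negP => /xk.
split=> [i ik|]; first by apply: ymin; exact: leq_ltn_trans km.
have Nm : (N < m)%N by exact: leq_ltn_trans km.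
have minS := bounded_size_min_step hB ho.
have maxS := bounded_size_max_step hB ho.
have [[_ _ _ /(_ (rng (x m))) two] _ _ _] := hB.2 m.
rewrite hL in two; last exact: leq_ltn_trans Nm.
have [xmmin ymmax] := succ_edge_two two xy; have [rg _ _] := xy.
have xlab := @min_prefix_label B (rev_order o) lab _ m x maxS xmax.
have ylab := @min_prefix_label B o lab _ m y minS ymin.
have xstep := minS _ _ xmmin.
have ystep := maxS _ _ ymmax.
have tm : (t m)%:Z%R = (\sum_(N <= i < m) (t i)%:Z)%R.
  have := ht (m - N)%N; rewrite subn_gt0 subnKC ?(ltnW Nm)// => ->//.
  exact: (big_morph Posz PoszD (erefl _)).
rewrite sumrN in xlab.
rewrite (big_cat_nat (n := N)) ?(ltnW Nm)//= -tm in xlab ylab.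
rewrite rg in ystep.
rewrite mulr2n; move: (bigop _ _ _) xlab ylab xstep ystep => S.
move: (lab m _) (lab m _) (lab m.+1 _) (lab 0 _) (lab 0 _) => a b c d e.
lia.
Qed.

Theorem theorem3p12 (B : bratteli) (lab : forall n, vertex B n -> int)
    (t L : nat -> nat) (o : edge_order B)
    (hB : bounded_size lab t L)
    (ho : left_to_right lab o)
    (hL : forall n, (0 < n)%N -> L n = 2)
    (ht : exists N, forall k, (0 < k)%N ->
      t (N + k)%N = (\sum_(N <= i < N + k) t i)%N) :
  exists f : path_space B -> path_space B, vershik_map o f /\ continuous f.
Proof.
have [N htN] := ht.
have minS := bounded_size_min_step hB ho.
have maxS := bounded_size_max_step hB ho.
have labB := hB.1; have labI n := bij_inj (labB n).
pose d := (- ((\sum_(0 <= i < N) (t i)%:Z) *+ 2))%R : int.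
have [f fP] := choice (fun x => vershik_ext_total d x labB minS).
have [g gP] := choice (fun y =>
  vershik_ext_total (- d)%R y labB maxS).
have fC : continuous f.
  apply: cylinder_continuous => x n; case: (fP x) => [[xmax fmin flab]|xfx].
    (* Beyond level [N], the image of any nearby path, maximal or not, starts
       at the same vertex as the image of [x] with a long minimal prefix. *)
    exists (maxn N n) => x' xx'.
    have start : lab 0 (src (x' 0)) = lab 0 (src (x 0)) by rewrite xx'.
    have [f'min f'lab] : (forall i, (i <= maxn N n)%N -> min_edge o (f x' i)) /\
        lab 0 (src (f x' 0)) = (lab 0 (src (x' 0)) + d)%R.
      case: (fP x') => [[_ f'min f'lab]|x'fx']; first by split=> // i _.
      apply: (vershik_graph_near_max hB ho hL htN _ _ x'fx').
        exact: leq_maxl.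
      by move=> i ik; rewrite xx'//; exact: xmax.
    move=> i; rewrite -ltnS; apply: (min_prefix_start_eq labI minS).
    - move=> j; rewrite ltnS => jn.
      by apply: f'min; rewrite leq_max jn orbT.
    - by move=> j _; exact: fmin.
    - by rewrite f'lab flab start.
  have [m [xm loc]] := vershik_graph_local xfx.
  exists (maxn m n) => x' xx'; case: (fP x') => [[x'max _ _]|x'fx' i ik].
    by case: xm; rewrite -xx' ?leq_maxl//; exact: x'max.
  by apply: (loc _ _ _ (leq_maxl m n) xx' x'fx'); rewrite leq_max ik orbT.
exists f; split=> //; split; last first.
- by move=> x xmax; case: (fP x) => [[]|].
- exact: continuous_borel.
have gP' y : vershik_ext o lab d (g y) y by apply/vershik_ext_rev; exact: gP.
have fP' x : vershik_ext (rev_order o) lab (- d)%R (f x) x.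
  by apply/vershik_ext_rev; rewrite opprK; exact: fP.
exists g => x.
  exact: (vershik_ext_functional labI maxS (gP (f x)) (fP' x)).
exact: (vershik_ext_functional labI minS (fP (g x)) (gP' x)).
Qed.
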